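(* Let $P$ and $Q$ be two polytopes in the same Euclidean space. Then $P$ has a summand homothetic to $Q$ if and only if $P$ and $P+Q$ have the same number of vertices.
   Context: A polytope is the (nonempty) convex hull of finitely many points. $P+Q=\{p+q : p\in P,\ q\in Q\}$ denotes the Minkowski sum. If $P=S+R$ for polytopes $S$ and $R$, then $S$ and $R$ are called summands of $P$. A polytope is homothetic to $Q$ if it is of the form $\alpha Q+t$ for some real number $\alpha>0$ and some translation vector $t$; thus $P$ has a summand homothetic to $Q$ exactly when $P=\alpha Q+R$ for some $\alpha>0$ and some polytope $R$. *)

(* Defs.v *)
From mathcomp Require Import all_boot all_order all_algebra.
From mathcomp Require Import boolp classical_sets functions cardinality reals.
From mathcomp Require Import convex.

Set Implicit Arguments.
Unset Strict Implicit.
Unset Printing Implicit Defensive.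

Import Order.TTheory GRing.Theory Num.Theory.

Local Open Scope classical_set_scope.
Local Open Scope ring_scope.

Section Polytopes.
Variables (R : realType) (d : nat).
Implicit Types (A B P Q S T : set 'rV[R]_d) (c v : 'rV[R]_d).

Definition conv_hull A : set 'rV[R]_d := smallest (@convex_set R 'rV[R]_d) A.

Definition polytope P : Prop :=
  P !=set0 /\ exists2 A, finite_set A & P = conv_hull A.

Definition minkowski_sum A B : set 'rV[R]_d := [set a + b | a in A & b in B].

Definition summand S P : Prop :=
  polytope S /\ exists2 T, polytope T & P = minkowski_sum S T.

Definition homothetic S Q : Prop :=
  exists (alpha : R) (t : 'rV[R]_d),
    0 < alpha /\ S = [set alpha *: x + t | x in Q].

Definition inner c v : R := \sum_(i < d) c 0 i * v 0 i.

(* The face of [P] cut out by its supporting hyperplane with outer normal [c];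
   [c = 0] gives [P] itself, so a one-point polytope has its point as a
   vertex. *)
Definition face P c : set 'rV[R]_d :=
  [set x | P x /\ forall y, P y -> inner c y <= inner c x].

(* Vertices are the zero-dimensional faces. *)
Definition vertices P : set 'rV[R]_d := [set v | exists c, face P c = [set v]].

End Polytopes.

(* Main.v *)
Require Import Defs.
From mathcomp Require Import all_boot all_order all_algebra.
From mathcomp Require Import boolp classical_sets functions cardinality reals.
From mathcomp Require Import finmap interval_inference convex ring lra.

(** Both conditions say that the normal fan of [P] refines that of [Q]: there
    is a map [psi] from the vertices of [P] to points of [Q] such that every
    linear form maximized over [P] at a vertex [p] is maximized over [Q] at
    [psi p] ([normal_refinement]).

    If [P = k Q + t + T] with [k > 0], write each vertex as
    [p = k q + t + z] and take [psi p = q]: a form maximal at a sum is maximal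
    at each term ([summand_normal_refinement]).

    The vertices of [P + Q] are the sums [p + q] for which a single form [c]
    exposes exactly [p] in [P] and exactly [q] in [Q], and such a
    decomposition is unique.  Perturbing a form to a generic one shows that
    each vertex [p] of [P] occurs in at least one such pair, so [P + Q] has at
    least as many vertices as [P], and the numbers agree exactly when [p]
    determines [q].  This is equivalent to the refinement of fans: in one
    direction [psi p] is the only candidate for [q]
    ([normal_refinement_card]); in the other, a form in the closed normal cone
    of [p] becomes one exposing [p] alone after adding a small multiple of a
    form in the interior of that cone ([card_normal_refinement]).

    Finally, suppose that [psi] refines.  If a form in the normal cone of [p]
    is also maximal at [p'], it takes the same value at [psi p] and [psi p'].
    As the normal cone is cut out by finitely many inequalities, Farkas' lemma
    turns this implication into an inequality
    [<c, psi p - psi p'> <= m <c, p - p'>] on the whole cone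
    ([normal_cone_domination]), with one [m > 0] for all pairs of vertices.
    With [k = 1/m], it says that [p - k psi p] maximizes every form of the
    normal cone of [p] over [T], the convex hull of all these points.  Hence
    [k Q + T] and [P] have the same support function, and are equal by
    separation ([normal_refinement_summand]). *)

Import Order.TTheory GRing.Theory Num.Theory.
Set Implicit Arguments.
Unset Strict Implicit.

Local Open Scope ring_scope.
Local Open Scope classical_set_scope.
Local Open Scope card_scope.

(** * The standard inner product *)

Section InnerProduct.
Variables (R : realType) (n : nat).
Implicit Types (u v w x y : 'rV[R]_n) (t : R).

Lemma innerC x y : inner x y = inner y x.
Proof. by apply: eq_bigr => i _; rewrite mulrC. Qed.

Lemma innerDr x y w : inner x (y + w) = inner x y + inner x w.
Proof. by rewrite -big_split; apply: eq_bigr => i _; rewrite mxE mulrDr. Qed.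

Lemma innerZr t x y : inner x (t *: y) = t * inner x y.
Proof. by rewrite mulr_sumr; apply: eq_bigr => i _; rewrite mxE mulrCA. Qed.

Lemma innerNr x y : inner x (- y) = - inner x y.
Proof. by rewrite -scaleN1r innerZr mulN1r. Qed.

Lemma innerBr x y w : inner x (y - w) = inner x y - inner x w.
Proof. by rewrite innerDr innerNr. Qed.

Lemma innerDl x y w : inner (y + w) x = inner y x + inner w x.
Proof. by rewrite innerC innerDr !(innerC x). Qed.

Lemma innerZl t x y : inner (t *: y) x = t * inner y x.
Proof. by rewrite innerC innerZr (innerC x). Qed.

Lemma innerNl x y : inner (- y) x = - inner y x.
Proof. by rewrite innerC innerNr (innerC x). Qed.

Lemma innerBl x y w : inner (y - w) x = inner y x - inner w x.
Proof. by rewrite innerDl innerNl. Qed.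

Lemma inner0r x : inner x 0 = 0.
Proof. by rewrite -(scale0r x) innerZr mul0r. Qed.

Definition innerE :=
  (innerDr, innerBr, innerNr, innerZr, innerDl, innerBl, innerNl, innerZl).

Lemma inner_self_ge0 x : 0 <= inner x x.
Proof. by apply: sumr_ge0 => i _; rewrite -expr2 sqr_ge0. Qed.

Lemma inner_self_eq0 x : inner x x = 0 -> x = 0.
Proof.
have sq i : 0 <= x 0 i * x 0 i by rewrite -expr2 sqr_ge0.
move=> /eqP; rewrite psumr_eq0 => [/allP x0|i _ //].
apply/rowP => i; rewrite mxE.
by have /(_ i (mem_index_enum i)) := x0; rewrite mulf_eq0 orbb => /eqP.
Qed.

Lemma inner_self_gt0 x : x != 0 -> 0 < inner x x.
Proof.
move=> x0; rewrite lt_neqAle inner_self_ge0 andbT.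
by apply: contra_neq x0 => /esym/inner_self_eq0.
Qed.

End InnerProduct.

(** * Farkas' lemma *)

Section Cones.
Variables (R : realType).

Definition convex_cone n (K : set 'rV[R]_n) : Prop :=
  [/\ K 0, forall x y, K x -> K y -> K (x + y)
    & forall (t : R) x, 0 <= t -> K x -> K (t *: x)].

(** The alternative between generation by [s] and separation from [s], with
    membership in the cone generated by [s] phrased as membership in every
    convex cone that contains [s]; no coefficients have to be manipulated, and
    applications choose [K] as the conclusion they want.  The proof is Bartl's
    induction on the number of generators: if dropping [a0] breaks the
    implication, a witness [x0] of the failure gives a projection along [a0]
    that sends the whole problem to one with fewer generators. *)
Lemma farkas n (s : seq 'rV[R]_n) (K : set 'rV[R]_n) b :
  convex_cone K -> (forall a, a \in s -> K a) ->
  (forall x, (forall a, a \in s -> inner x a <= 0) -> inner x b <= 0) -> K b.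
Proof.
move: {2}(size s) (erefl (size s)) => m.
elim: m s K b => [|m IH] [|a0 s] //= K b.
  move=> _ [K0 _ _] _ /(_ b) /(_ (fun _ => ltac:(by []))) bb.
  by rewrite (@inner_self_eq0 _ _ b)//; apply/eqP; rewrite eq_le bb inner_self_ge0.
move=> [sz] Kc sK ineq.
have [K0 KD KZ] := Kc.
have sK' a : a \in s -> K a by move=> ?; apply: sK; rewrite inE; apply/orP; right.
have [nec|] := pselect (forall x, (forall a, a \in s -> inner x a <= 0) ->
                           inner x b <= 0).
  exact: (IH s K b).
move=> /existsNP [x /not_implyP [xs /negP]]; rewrite -ltNge => xb.
have xa0 : 0 < inner x a0.
  rewrite ltNge; apply/negP => xa0; have : inner x b <= 0.
    by apply: ineq => a; rewrite inE => /orP[/eqP->//|/xs].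
  by rewrite leNgt xb.
have [x0 [x0a0 x0s x0b]] : exists x0, [/\ inner x0 a0 = 1,
    forall a, a \in s -> inner x0 a <= 0 & 0 < inner x0 b].
  exists ((inner x a0)^-1 *: x); split; rewrite ?innerZl.
  - by rewrite mulVf// gt_eqF.
  - by move=> a /xs xa; rewrite innerZl pmulr_rle0// invr_gt0.
  - by rewrite mulr_gt0// invr_gt0.
(* the projection along [a0] onto the hyperplane orthogonal to [x0] *)
pose pr a := a - inner x0 a *: a0.
(* Recording [inner x0 k <= 0] is what makes the coefficient of [a0] in the
   final expression of [b] nonnegative. *)
pose K' : set 'rV[R]_n := [set y | exists k, [/\ K k, inner x0 k <= 0 & y = pr k]].
have Kc' : convex_cone K'.
  split.
  - exists 0; rewrite /pr inner0r scale0r subr0; split=> //.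
  - move=> _ _ [k [Kk k0 ->]] [l [Kl l0 ->]]; exists (k + l); split.
    + exact: KD.
    + by rewrite innerDr; lra.
    + by rewrite /pr innerDr scalerDl opprD addrACA.
  - move=> t _ t0 [k [Kk k0 ->]]; exists (t *: k); split.
    + exact: KZ.
    + by rewrite innerZr mulr_ge0_le0.
    + by rewrite /pr innerZr scalerBr scalerA.
have := IH (map pr s) K' (pr b).
case=> //.
- by rewrite size_map.
- by move=> _ /mapP[a ai ->]; exists a; split; [exact: sK'|exact: x0s|].
- move=> y ys; pose y' := y - inner y a0 *: x0.
  have prE a : inner y (pr a) = inner y' a.
    by rewrite /pr /y' !innerE; ring.
  rewrite prE; apply: ineq => a; rewrite inE => /orP[/eqP->|ai].
    by rewrite /y' !innerE x0a0 mulr1 subrr.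
  by rewrite -prE; apply: ys; apply: map_f.
move=> k [Kk k0] /eqP; rewrite /pr subr_eq => /eqP ->.
rewrite -addrA addrC -scaleNr -scalerDl addrC; apply: KD => //.
apply: KZ; [lra | apply: sK]. by rewrite mem_head.
Qed.

End Cones.

(** * Convex hulls of finite sets and separation *)

Section Hulls.
Variables (R : realType) (d : nat).
Implicit Types (A B P Q : set 'rV[R]_d) (a b c p q u v w x y : 'rV[R]_d).
Implicit Types (s r : seq 'rV[R]_d) (m t : R).

Lemma convex_setP A : @convex_set R 'rV[R]_d A <->
  forall x y t, 0 <= t <= 1 -> A x -> A y -> A (t *: x + (1 - t) *: y).
Proof.
split=> [cA x y t /andP[t0 t1] Ax Ay|cA x y t].
  exact: (set_mem (cA x y (Itv01 t0 t1) (mem_set Ax) (mem_set Ay))).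
move=> /set_mem Ax /set_mem Ay; apply/mem_set/cA => //.
by apply/andP; split; [exact: ge0|exact: le1].
Qed.

Lemma convex_halfspace c m : @convex_set R 'rV[R]_d [set x | inner c x <= m].
Proof.
apply/convex_setP => x y t /andP[t0 t1] /= xm ym; rewrite !innerE; nra.
Qed.

Lemma sub_conv_hull A : A `<=` conv_hull A.
Proof. exact: sub_gen_smallest. Qed.

Lemma convex_conv_hull A : @convex_set R 'rV[R]_d (conv_hull A).
Proof.
apply/convex_setP => x y t t01 Ax Ay B [/[dup] cB /convex_setP cB' AB].
by apply: cB' => //; [apply: Ax|apply: Ay].
Qed.

Lemma conv_hull_min A B :
  @convex_set R 'rV[R]_d B -> A `<=` B -> conv_hull A `<=` B.
Proof. exact: smallest_sub. Qed.

Lemma conv_hull_le A c m :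
  (forall a, A a -> inner c a <= m) -> forall x, conv_hull A x -> inner c x <= m.
Proof. by move=> Am; apply: conv_hull_min; [exact: convex_halfspace|]. Qed.

Lemma inner_row_mx k l (c x : 'rV[R]_k) (e y : 'rV[R]_l) :
  inner (row_mx c e) (row_mx x y) = inner c x + inner e y.
Proof.
by rewrite /inner big_split_ord; congr (_ + _); apply: eq_bigr => i _;
  rewrite !(row_mxEl, row_mxEr).
Qed.

(** A point of the hull of [s] is a point [x] for which [(x, 1)] lies in the
    cone generated by the points [(a, 1)], so Farkas' lemma one dimension up
    gives the separating affine form. *)
Lemma conv_hull_separation s x : s != [::] ->
  (forall c m, (forall a, a \in s -> inner c a <= m) -> inner c x <= m) ->
  conv_hull [set` s] x.
Proof.
case: s => // a0 s0 _; set s := a0 :: s0 => sep.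
set P := conv_hull _.
have /convex_setP cP := @convex_conv_hull [set` s].
have Ps a : a \in s -> P a by move=> ai; exact: sub_conv_hull.
have Pa0 : P a0 by apply: Ps; rewrite inE eqxx.
pose lift (y : 'rV[R]_d) : 'rV[R]_(d + 1) := row_mx y 1%:M.
(* the convex cone over [P] placed at height one *)
pose K : set 'rV[R]_(d + 1) :=
  [set z | exists t y, [/\ 0 <= t, P y & z = t *: lift y]].
have Kc : convex_cone K.
  split.
  - by exists 0, a0; rewrite scale0r.
  - move=> _ _ [t [y [t0 Py ->]]] [t' [y' [t'0 Py' ->]]].
    have [tt|tt] := eqVneq (t + t') 0.
      have [-> ->] : t = 0 /\ t' = 0 by lra.
      by exists 0, a0; rewrite !scale0r addr0.
    exists (t + t'), (t / (t + t') *: y + (1 - t / (t + t')) *: y'); split.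
    + exact: addr_ge0.
    + have tt0 : 0 < t + t' by rewrite lt_neqAle eq_sym tt addr_ge0.
      apply: cP => //; rewrite divr_ge0//= ?addr_ge0// ler_pdivrMr// mul1r.
      by rewrite lerDl.
    + rewrite /lift !scale_row_mx add_row_mx -scalerDl scalerDr !scalerA.
      by congr (row_mx (_ *: _ + _ *: _) _); field.
  - move=> t _ t0 [t' [y' [t'0 Py' ->]]]; exists (t * t'), y'; split=> //.
      exact: mulr_ge0.
    by rewrite scalerA.
have [] := @farkas R _ (map lift s) K (lift x) Kc.
- by move=> _ /mapP[a ai ->]; exists 1, a; rewrite scale1r; split=> //; apply: Ps.
- move=> z; rewrite -(hsubmxK z) => zs.
  rewrite inner_row_mx -lerBrDr sub0r; apply: sep => a ai.
  by rewrite -sub0r lerBrDr -inner_row_mx; apply: zs (map_f lift ai).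
move=> t [y [t0 Py]]; rewrite /lift scale_row_mx => /eq_row_mx[-> /matrixP].
by move=> /(_ 0 0); rewrite !mxE eqxx mulr1 => <-; rewrite scale1r.
Qed.

Lemma exists_max_seq (f : 'rV[R]_d -> R) s : s != [::] ->
  exists2 a, a \in s & forall b, b \in s -> f b <= f a.
Proof.
elim: s => // a [|b s] IH _.
  by exists a; rewrite ?mem_head// => b; rewrite inE => /eqP ->.
have [//|e ei emax] := IH; have [ae|ea] := leP (f a) (f e).
  by exists e; [rewrite inE ei orbT|move=> z; rewrite inE => /orP[/eqP->|/emax]].
exists a; first by rewrite mem_head.
move=> z; rewrite inE => /orP[/eqP->//|/emax/le_trans->//]; exact: ltW.
Qed.

(** * Generic linear forms *)

Lemma inner_pos_perturb c u s : exists2 e : R, 0 < e &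
  forall w, w \in s -> 0 < inner c w -> 0 < inner (c + e *: u) w.
Proof.
suff [e e0 he] : exists2 e : R, 0 < e & forall t, 0 < t <= e ->
    forall w, w \in s -> 0 < inner c w -> 0 < inner (c + t *: u) w.
  by exists e => //; apply: he; rewrite e0 lexx.
elim: s => [|w s [e e0 IH]]; first by exists 1.
have [cw|cw] := leP (inner c w) 0.
  exists e => // t te z; rewrite inE => /orP[/eqP->|]; last exact: IH.
  by rewrite ltNge cw.
(* A step [t <= inner c w / (1 + L)] costs at most [t * L <= inner c w - t]. *)
set L := `|inner u w|; have L0 : 0 <= L by exact: normr_ge0.
exists (Num.min e (inner c w / (1 + L))).
  by rewrite lt_min e0 divr_gt0//; lra.
move=> t /andP[t0]; rewrite le_min => /andP[te]; rewrite ler_pdivlMr; last lra.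
move=> tL z; rewrite inE => /orP[/eqP-> _|zi]; last by apply: IH; rewrite // t0.
rewrite !innerE; have : - L <= inner u w by rewrite lerNl /L -normrN ler_norm.
nra.
Qed.

(** Only finitely many hyperplanes have to be avoided.  They are left one at a
    time, moving along the normal vector [w] by a step small enough to keep
    every sign already fixed. *)
Lemma generic_perturb c s r : exists c',
  (forall w, w \in s -> 0 < inner c w -> 0 < inner c' w) /\
  (forall w, w \in r -> w != 0 -> inner c' w != 0).
Proof.
elim: r => [|w r [c' [pos neq]]]; first by exists c.
have [w0|w0] := eqVneq w 0.
  exists c'; split=> // z; rewrite inE => /orP[/eqP->|]; last exact: neq.
  by rewrite w0 eqxx.
have [cw|cw] := eqVneq (inner c' w) 0; last first.
  by exists c'; split=> // z; rewrite inE => /orP[/eqP->|]; last exact: neq.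
have [e e0 he] := inner_pos_perturb c' w (s ++ r ++ map -%R r).
exists (c' + e *: w); split=> z.
  by move=> zi cz; apply: he; [rewrite mem_cat zi|apply: pos].
rewrite inE => /orP[/eqP-> _|zi z0].
  by rewrite !innerE cw add0r mulf_neq0 ?gt_eqF ?inner_self_gt0.
have := neq _ zi z0; rewrite neq_lt => /orP[cz|cz]; last first.
  by rewrite gt_eqF// he// !mem_cat zi orbT.
rewrite -oppr_eq0 -innerNr gt_eqF// he ?innerNr ?oppr_gt0//.
by rewrite !mem_cat map_f ?orbT.
Qed.

(** A second maximizer [y] is excluded by tilting [c] slightly towards
    [y - a]: [a] still beats the other generators, hence all of the hull, yet
    [y] would now be strictly better than [a]. *)
Lemma face_strict_max s c a : a \in s ->
  (forall b, b \in s -> b != a -> inner c b < inner c a) ->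
  face (conv_hull [set` s]) c = [set a].
Proof.
move=> ai amax.
have max1 (c' : 'rV[R]_d) : (forall b, b \in s -> b != a -> inner c' b < inner c' a) ->
    forall y, conv_hull [set` s] y -> inner c' y <= inner c' a.
  move=> h; apply: conv_hull_le => b /= bi; have [->//|/h-/(_ bi)/ltW//] := eqVneq b a.
apply/seteqP; split=> [y [Py ymax]|_ ->]; last first.
  by split; [exact: sub_conv_hull|exact: max1].
have [e e0 he] := inner_pos_perturb c (y - a) [seq a - b | b <- s].
have : inner (c + e *: (y - a)) y <= inner (c + e *: (y - a)) a.
  apply: max1 => // b bi ba; rewrite -subr_gt0 -innerBr; apply: he.
    exact: map_f.
  by rewrite innerBr subr_gt0 amax.
have cya : inner c y = inner c a.
  by apply/eqP; rewrite eq_le max1//= ymax//; exact: sub_conv_hull.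
rewrite !(innerDl _ c) !innerZl cya lerD2l ler_pM2l// -subr_le0 -innerBr => ya.
apply/eqP; rewrite -subr_eq0; apply/eqP/inner_self_eq0/eqP.
by rewrite eq_le ya inner_self_ge0.
Qed.

(** * Vertices of polytopes and of Minkowski sums *)

Lemma polytope_seq P : polytope P ->
  exists2 s, s != [::] & P = conv_hull [set` s].
Proof.
move=> [[x Px] [A /finite_seqP[s ->] PE]]; exists s => //.
by apply/eqP => s0; move: Px; rewrite PE s0 => /(_ set0); apply; split=> //.
Qed.

Lemma exists_exposed_point s c c' : s != [::] ->
  (forall a b, a \in s -> b \in s -> 0 < inner c (a - b) -> 0 < inner c' (a - b)) ->
  (forall a b, a \in s -> b \in s -> a - b != 0 -> inner c' (a - b) != 0) ->
  exists2 a, face (conv_hull [set` s]) c' = [set a]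
           & face (conv_hull [set` s]) c a.
Proof.
move=> s0 pos neq; have [a ai amax] := exists_max_seq (inner c') s0.
exists a.
  apply: face_strict_max => // b bi ba; rewrite lt_neqAle amax// andbT.
  by rewrite -subr_eq0 -innerBr neq// subr_eq0.
split; first exact: sub_conv_hull.
apply: conv_hull_le => b bi; rewrite leNgt -subr_gt0 -innerBr; apply/negP.
by move=> /(pos _ _ bi ai); rewrite innerBr subr_gt0 ltNge amax.
Qed.

(** A form [c] can be perturbed so as to expose a single point in [P] and in
    [Q] at once, without leaving the faces exposed by [c].  This one fact
    supplies vertices of [P], and vertices of [P + Q] above a given vertex
    of [P]. *)
Lemma generic_faces P Q c : polytope P -> polytope Q ->
  exists c' p q, [/\ face P c' = [set p], face Q c' = [set q],
                     face P c p & face Q c q].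
Proof.
move=> /polytope_seq[s s0 ->] /polytope_seq[r r0 ->].
pose D (l : seq 'rV[R]_d) := [seq a - b | a <- l, b <- l].
have [c' [pos neq]] := generic_perturb c (D s ++ D r) (D s ++ D r).
have sD a b : a \in s -> b \in s -> a - b \in D s ++ D r.
  by move=> ai bi; rewrite mem_cat (allpairs_f (fun a b => a - b)).
have rD a b : a \in r -> b \in r -> a - b \in D s ++ D r.
  by move=> ai bi; rewrite mem_cat (allpairs_f (fun a b => a - b) ai bi) orbT.
have [p Pp cp] : exists2 a, face (conv_hull [set` s]) c' = [set a]
                        & face (conv_hull [set` s]) c a.
  by apply: exists_exposed_point => // a b ai bi; [exact/pos/sD|exact/neq/sD].
have [q Qq cq] : exists2 a, face (conv_hull [set` r]) c' = [set a]
                        & face (conv_hull [set` r]) c a.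
  by apply: exists_exposed_point => // a b ai bi; [exact/pos/rD|exact/neq/rD].
by exists c', p, q.
Qed.

Lemma exists_vertex_face P c : polytope P -> exists2 p, vertices P p & face P c p.
Proof.
move=> hP; have [c' [p [_ [Pp _ cp _]]]] := generic_faces c hP hP.
by exists p => //; exists c'.
Qed.

Lemma vertices_sub P : vertices P `<=` P.
Proof. by move=> p [c Pc]; have : [set p] p by []; rewrite -Pc => -[]. Qed.

Lemma finite_vertices P : polytope P -> finite_set (vertices P).
Proof.
move=> /polytope_seq[s s0 ->]; apply: (sub_finite_set _ (finite_seq s)).
move=> p [c pc] /=.
have [a ai amax] := exists_max_seq (inner c) s0.
have : face (conv_hull [set` s]) c a.
  by split; [exact: sub_conv_hull|exact: conv_hull_le].
by rewrite pc => <-.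
Qed.

Lemma finite_hull_separation A x : finite_set A -> A !=set0 ->
  (forall c m, (forall a, A a -> inner c a <= m) -> inner c x <= m) ->
  conv_hull A x.
Proof.
move=> /finite_seqP[s ->] [a ai]; apply: conv_hull_separation.
by apply: contraPneq ai => ->.
Qed.

Lemma polytope_hull_vertices P : polytope P -> P = conv_hull (vertices P).
Proof.
move=> hP; apply/seteqP; split=> [x Px|].
  apply: finite_hull_separation; first exact: finite_vertices.
    by have [p] := exists_vertex_face 0 hP; exists p.
  move=> c m vm; have [p Vp [_ cp]] := exists_vertex_face c hP.
  exact: le_trans (cp _ Px) (vm _ Vp).
have [_ [A _ PE]] := hP.
by apply: conv_hull_min; [rewrite {1}PE; exact: convex_conv_hull|exact: vertices_sub].
Qed.

Lemma polytope_homothetic Q t u : polytope Q ->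
  polytope [set t *: x + u | x in Q].
Proof.
move=> [[x Qx] [A fA QE]]; split; first by exists (t *: x + u), x.
exists [set t *: x + u | x in A]; first exact: finite_image.
have comb k y z : t *: (k *: y + (1 - k) *: z) + u =
    k *: (t *: y + u) + (1 - k) *: (t *: z + u).
  rewrite !scalerDr !scalerA !(mulrC t) addrACA -scalerDl.
  by rewrite [k + _]addrC subrK scale1r.
apply/seteqP; split=> [_ [y + <-]|].
  have cvx : @convex_set R 'rV[R]_d
      [set y | conv_hull [set t *: x + u | x in A] (t *: y + u)].
    apply/convex_setP => y' z k k01 /= hy hz; rewrite comb.
    by move/convex_setP: (@convex_conv_hull [set t *: x + u | x in A]); apply.
  rewrite QE; move: y; apply: conv_hull_min => // y Ay /=.
  by apply: sub_conv_hull; exists y.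
apply: conv_hull_min; last first.
  by move=> _ [y Ay <-]; exists y => //; rewrite QE; exact: sub_conv_hull.
apply/convex_setP => _ _ k k01 [y Qy <-] [z Qz <-].
exists (k *: y + (1 - k) *: z) => //; rewrite QE in Qy Qz *.
by move/convex_setP: (@convex_conv_hull A); apply.
Qed.

Lemma convex_minkowski_sum A B : @convex_set R 'rV[R]_d A ->
  @convex_set R 'rV[R]_d B -> @convex_set R 'rV[R]_d (minkowski_sum A B).
Proof.
move=> /convex_setP cA /convex_setP cB; apply/convex_setP.
move=> _ _ k k01 [a Aa [b Bb <-]] [a' Aa' [b' Bb' <-]].
exists (k *: a + (1 - k) *: a'); first exact: cA.
exists (k *: b + (1 - k) *: b'); first exact: cB.
by rewrite addrACA -!scalerDr.
Qed.

Lemma polytope_convex P : polytope P -> @convex_set R 'rV[R]_d P.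
Proof. by move=> [_ [A _ ->]]; exact: convex_conv_hull. Qed.

Lemma face_minkowski_sum P Q c p q : P p -> Q q ->
  face (minkowski_sum P Q) c (p + q) <-> face P c p /\ face Q c q.
Proof.
move=> Pp Qq; split=> [[_ pq]|[[_ cp] [_ cq]]].
  split; split=> // y Hy.
    have := pq (y + q); rewrite !innerDr lerD2r; apply.
    by exists y => //; exists q.
  have := pq (p + y); rewrite !innerDr lerD2l; apply.
  by exists p => //; exists y.
split; first by exists p => //; exists q.
by move=> _ [y Py [z Qz <-]]; rewrite !innerDr lerD ?cp ?cq.
Qed.

Lemma face_set1 P c p : face P c = [set p] -> face P c p.
Proof. by move=> ->. Qed.

Lemma face_minkowski_sum1 P Q c p q : face P c = [set p] -> face Q c = [set q] ->
  face (minkowski_sum P Q) c = [set p + q].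
Proof.
move=> Pc Qc; have [[Pp cp] [Qq cq]] := (face_set1 Pc, face_set1 Qc).
apply/seteqP; split=> [v|_ ->]; last by apply/face_minkowski_sum.
move=> /[dup] -[[y Py [z Qz <-]] _] /face_minkowski_sum-/(_ Py Qz)[].
by rewrite Pc Qc => -> ->.
Qed.

Lemma vertices_minkowski_sum P Q v : vertices (minkowski_sum P Q) v <->
  exists c p q, [/\ face P c = [set p], face Q c = [set q] & v = p + q].
Proof.
split=> [[c vc]|[c [p [q [Pc Qc ->]]]]]; last first.
  by exists c; exact: face_minkowski_sum1.
have := face_set1 vc => /[dup] -[[p Pp [q Qq pqv]] _].
rewrite -pqv in vc * => /(face_minkowski_sum _ Pp Qq)[cp cq].
exists c, p, q; split=> //; apply/seteqP; split=> [y cy|_ ->//].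
- have : face (minkowski_sum P Q) c (y + q).
    by apply/face_minkowski_sum => //; case: cy.
  by rewrite vc => /addIr.
- have : face (minkowski_sum P Q) c (p + y).
    by apply/face_minkowski_sum => //; case: cy.
  by rewrite vc => /addrI.
Qed.

(** A vertex of the sum decomposes in only one way: any summands of [p + q] are
    themselves maximal for [c]. *)
Lemma minkowski_vertex_inj P Q c p q p' q' :
  face P c = [set p] -> face Q c = [set q] -> P p' -> Q q' ->
  p' + q' = p + q -> p' = p /\ q' = q.
Proof.
move=> Pc Qc Pp' Qq' e.
have : face (minkowski_sum P Q) c (p' + q').
  by rewrite (face_minkowski_sum1 Pc Qc).
by rewrite face_minkowski_sum// Pc Qc.
Qed.

End Hulls.

(** * Refinement of normal fans *)

Section Summands.
Variables (R : realType) (d : nat).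
Implicit Types (A B P Q : set 'rV[R]_d) (a b c p q u v w x y : 'rV[R]_d).
Implicit Types (s r : seq 'rV[R]_d) (m t : R).

(** The normal cone of [P] at each vertex [p] lies in the normal cone of [Q] at
    [psi p]. *)
Definition normal_refinement P Q (psi : 'rV[R]_d -> 'rV[R]_d) : Prop :=
  forall p c, vertices P p -> face P c p -> face Q c (psi p).

Lemma summand_normal_refinement P Q S : summand S P -> homothetic S Q ->
  exists psi, normal_refinement P Q psi.
Proof.
move=> [_ [T _ PST]] [k [t [k0 SQ]]].
have decomp p : exists q, P p ->
    Q q /\ exists2 z, T z & p = (k *: q + t) + z.
  have [|nPp] := pselect (P p); last by exists 0.
  rewrite PST SQ => -[_ [q Qq <-] [z Tz <-]].
  by exists q => _; split=> //; exists z.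
have [psi psiP] := choice decomp; exists psi => p c _ [Pp cp].
have [Qq [z Tz pE]] := psiP p Pp; split=> // y Qy.
have : P ((k *: y + t) + z).
  by rewrite PST SQ; exists (k *: y + t); [exists y|exists z].
by move=> /cp; rewrite {1}pE !innerDr !innerZr !lerD2r ler_pM2l.
Qed.

Lemma exposed_sum_inj P Q (psi : 'rV[R]_d -> 'rV[R]_d) :
  (forall p, vertices P p ->
     exists c, face P c = [set p] /\ face Q c = [set psi p]) ->
  {in vertices P &, injective (fun p => p + psi p)}.
Proof.
move=> pair p p' /set_mem Vp /set_mem Vp' e.
have [[c [Pc Qc]] [c' [Pc' Qc']]] := (pair _ Vp, pair _ Vp').
have [Pp _] := face_set1 Pc; have [Qp _] := face_set1 Qc.
by have [] := minkowski_vertex_inj Pc' Qc' Pp Qp e.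
Qed.

(** The bijection is [p |-> p + psi p]. *)
Lemma normal_refinement_card P Q psi : polytope P -> polytope Q ->
  normal_refinement P Q psi -> vertices P #= vertices (minkowski_sum P Q).
Proof.
move=> hP hQ ref.
have pair p : vertices P p -> exists c, face P c = [set p] /\ face Q c = [set psi p].
  move=> /[dup] Vp [c pc]; have [c' [p' [q' [Pc' Qc' cp' _]]]] := generic_faces c hP hQ.
  have e : p' = p by rewrite pc in cp'.
  rewrite {}e in Pc' *; exists c'; split=> //.
  by have := ref p c' Vp (face_set1 Pc'); rewrite Qc' => ->.
have <- : (fun p => p + psi p) @` vertices P = vertices (minkowski_sum P Q).
  apply/seteqP; split=> [_ [p /pair[c [Pc Qc]] <-]|v].
    by exists c; exact: face_minkowski_sum1.
  move=> /vertices_minkowski_sum [c [p [q [Pc Qc ->]]]].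
  have Vp : vertices P p by exists c.
  by exists p => //; have := ref p c Vp (face_set1 Pc); rewrite Qc => ->.
by rewrite card_eq_sym; apply: inj_card_eq; exact: exposed_sum_inj pair.
Qed.

Lemma inj_card_eq_image (T U : choiceType) (A : set T) (B : set U) (f : T -> U) :
  finite_set A -> A #= B -> {in A &, injective f} -> f @` A `<=` B -> f @` A = B.
Proof.
move=> fA AB finj fAB; have fB : finite_set B by rewrite -(eq_finite_set AB).
have ffA : finite_set (f @` A) by exact: finite_image.
apply: fset_set_inj => //; apply/eqP; rewrite eqEfcard; apply/andP; split.
  by rewrite -fset_set_sub.
have /fcard_eq-/(_ ffA fB) -> // : f @` A #= B.
exact: card_eq_trans (inj_card_eq finj) AB.
Qed.

(** For each vertex [p] choose a [psi p] exposed together with [p].  Then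
    [p |-> p + psi p] is an injection between equinumerous finite sets of
    vertices, so it is onto, and no vertex of [P + Q] other than [p + psi p]
    can lie above [p]. *)
Lemma card_normal_refinement P Q : polytope P -> polytope Q ->
  vertices P #= vertices (minkowski_sum P Q) -> exists psi, normal_refinement P Q psi.
Proof.
move=> hP hQ PQ.
have exq p : exists q, vertices P p ->
    exists c, face P c = [set p] /\ face Q c = [set q].
  have [[c pc]|nVp] := pselect (vertices P p); last by exists 0.
  have [c' [p' [q [Pc' Qc' cp' _]]]] := generic_faces c hP hQ.
  exists q => _; exists c'; split=> //.
  by rewrite Pc'; move: cp'; rewrite pc => ->.
have [psi pair] := choice exq; exists psi.
have img : (fun p => p + psi p) @` vertices P = vertices (minkowski_sum P Q).
  apply: inj_card_eq_image PQ _ _; first exact: finite_vertices.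
    exact: exposed_sum_inj pair.
  by move=> _ [p /pair[c [Pc Qc]] <-]; exists c; exact: face_minkowski_sum1.
have uniq p q c : face P c = [set p] -> face Q c = [set q] -> q = psi p.
  move=> Pc Qc; have : vertices (minkowski_sum P Q) (p + q).
    by exists c; exact: face_minkowski_sum1.
  rewrite -img => -[p' /pair[c' [Pc' Qc']] e].
  have [[Pp' _] [Qp' _]] := (face_set1 Pc', face_set1 Qc').
  by have [<- <-] := minkowski_vertex_inj Pc Qc Pp' Qp' e.
move=> p c Vp [Pp cp]; have [c0 [Pc0 Qc0]] := pair p Vp.
have [Qp _] := face_set1 Qc0; split=> // y Qy.
rewrite leNgt -subr_gt0 -innerBr; apply/negP => yp.
(* If [y] beat [psi p] for [c], it would still do so for [c + e *: c0], which
   exposes [p] alone; a generic perturbation of that form would then expose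
   [p] together with a point of [Q] other than [psi p]. *)
have [e e0 /(_ (y - psi p) (mem_head _ _) yp)] :=
  inner_pos_perturb c c0 [:: y - psi p].
rewrite innerBr subr_gt0 ltNge => /negP; apply.
have Pe : face P (c + e *: c0) = [set p].
  apply/seteqP; split=> [z [Pz zmax]|_ ->].
    rewrite -Pc0; split=> // x Px; have [_ c0p] := face_set1 Pc0.
    have := zmax _ Pp; have := cp _ Pz; have := c0p _ Px.
    by rewrite !innerE => ? ? ?; nra.
  split=> // x Px; have [_ c0p] := face_set1 Pc0.
  by have := cp _ Px; have := c0p _ Px; rewrite !innerE => ? ?; nra.
have [c' [p' [q' [Pc' Qc' cp' cq']]]] := generic_faces (c + e *: c0) hP hQ.
rewrite Pe in cp'; rewrite cp' in Pc'.
by case: cq' => _; rewrite (uniq _ _ _ Pc' Qc'); apply.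
Qed.

(** A form [c] in the normal cone of [p] with [<c, p - p'> <= 0] is maximal at
    both vertices, so that [<c, psi p - psi p'> <= 0].  Farkas' lemma makes
    [psi p - psi p'] a nonnegative combination of [p - p'] and the
    [a - p]; the latter are nonpositive on the normal cone, and [m] is the
    coefficient of [p - p']. *)
Lemma normal_cone_domination P Q psi p p' : polytope P ->
  normal_refinement P Q psi -> vertices P p -> vertices P p' ->
  exists2 m, 0 <= m & forall c, face P c p ->
    inner c (psi p - psi p') <= m * inner c (p - p').
Proof.
move=> /polytope_seq[s s0 PE] ref Vp Vp'.
have [Pp Pp'] := (vertices_sub Vp, vertices_sub Vp').
(* The vectors that satisfy the desired bound, for some [m], form a convex
   cone containing all the generators. *)
pose K : set 'rV[R]_d := [set b | exists2 m, 0 <= m &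
  forall c, face P c p -> inner c b <= m * inner c (p - p')].
have Kc : convex_cone K.
  split.
  - by exists 0 => // c _; rewrite inner0r mul0r.
  - move=> x y [m m0 xm] [m' m'0 ym']; exists (m + m'); first exact: addr_ge0.
    by move=> c cp; rewrite innerDr mulrDl lerD ?xm ?ym'.
  - move=> t x t0 [m m0 xm]; exists (t * m); first exact: mulr_ge0.
    by move=> c cp; rewrite innerZr -mulrA ler_wpM2l// xm.
apply: (@farkas R d ((p - p') :: [seq a - p | a <- s]) K) => //.
- move=> b; rewrite inE => /orP[/eqP->|/mapP[a ai ->]].
    by exists 1 => // c _; rewrite mul1r.
  exists 0 => // c [_ cp]; rewrite mul0r innerBr subr_le0; apply: cp.
  by rewrite PE; exact: sub_conv_hull.
- move=> c cs.
  have cpp' : inner c p <= inner c p'.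
    by rewrite -subr_le0 -innerBr cs ?mem_head.
  have cp x : P x -> inner c x <= inner c p.
    move: x; rewrite PE; apply: conv_hull_le => a ai.
    by rewrite -subr_le0 -innerBr cs// inE (map_f (fun a => a - p) ai) orbT.
  have [Qp cq] : face Q c (psi p) by apply: ref.
  have [Qp' cq'] : face Q c (psi p').
    by apply: ref => //; split=> // x /cp/le_trans; apply.
  by rewrite innerBr subr_le0; exact: cq'.
Qed.

Lemma finite_uniform_bound (T : eqType) (s : seq T) (F : T -> R -> Prop) :
  (forall i (m m' : R), m <= m' -> F i m -> F i m') ->
  (forall i, i \in s -> exists m, F i m) ->
  exists m, forall i, i \in s -> F i m.
Proof.
move=> mono; elim: s => [|i s IH] ex; first by exists 0.
have [m sm] := IH (fun j js => ex j (mem_behead (s := i :: s) js)).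
have [m' im'] := ex i (mem_head _ _).
exists (Num.max m m') => j; rewrite inE => /orP[/eqP->|/sm].
  by apply: mono im'; rewrite le_max lexx orbT.
by apply: mono; rewrite le_max lexx.
Qed.

Lemma normal_cone_uniform_domination P Q psi : polytope P ->
  normal_refinement P Q psi ->
  exists2 m, 0 < m & forall p p' c, vertices P p -> vertices P p' ->
    face P c p -> inner c (psi p - psi p') <= m * inner c (p - p').
Proof.
move=> hP ref; have /finite_seqP[s sE] := finite_vertices hP.
have sV p : p \in s -> vertices P p by rewrite sE.
have mono p p' m m' c : p' \in s -> face P c p -> m <= m' ->
    inner c (psi p - psi p') <= m * inner c (p - p') ->
    inner c (psi p - psi p') <= m' * inner c (p - p').
  move=> /sV/vertices_sub Pp' [_ cp] mm' /le_trans; apply.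
  by rewrite ler_wpM2r// innerBr subr_ge0 cp.
pose F (i : 'rV[R]_d * 'rV[R]_d) m := i.2 \in s -> forall c, face P c i.1 ->
  inner c (psi i.1 - psi i.2) <= m * inner c (i.1 - i.2).
have [] := @finite_uniform_bound _ [seq (p, p') | p <- s, p' <- s] F.
- by move=> i m m' mm' Fm si c cp; apply: mono mm' (Fm si c cp).
- move=> _ /allpairsP[[p p'] [/= ps p's ->]].
  have [m _ pm] := normal_cone_domination hP ref (sV _ ps) (sV _ p's).
  by exists m => _.
move=> m Fm; exists (Num.max m 1); first by rewrite lt_max ltr01 orbT.
move=> p p' c; rewrite sE /= => ps p's cp.
apply: (@mono _ _ m) => //; first by rewrite le_max lexx.
by apply: (Fm (p, p')) => //; exact: allpairs_f.
Qed.

(** The complementary summand is spanned by what is left of each vertex [p] of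
    [P] once [k *: psi p] is removed; [domk] says that these remainders are
    maximized by the same forms as the vertices they come from. *)
Lemma normal_refinement_summand P Q psi : polytope P -> polytope Q ->
  normal_refinement P Q psi ->
  exists S, summand S P /\ homothetic S Q.
Proof.
move=> hP hQ ref.
have [m m0 dom] := normal_cone_uniform_domination hP ref.
pose k := m^-1; have k0 : 0 < k by rewrite invr_gt0.
have domk p p' c : vertices P p -> vertices P p' -> face P c p ->
    inner c (p' - k *: psi p') <= inner c (p - k *: psi p).
  move=> Vp Vp' cp; have := dom p p' c Vp Vp' cp.
  by rewrite -ler_pdivrMl// -/k !innerE; lra.
pose S := [set k *: x + 0 | x in Q].
pose T := conv_hull [set p - k *: psi p | p in vertices P].
have hS : polytope S by exact: polytope_homothetic.
have [p0 Vp0 _] := exists_vertex_face 0 hP.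
have hT : polytope T.
  split; first by exists (p0 - k *: psi p0); apply: sub_conv_hull; exists p0.
  exists [set p - k *: psi p | p in vertices P] => //.
  exact/finite_image/finite_vertices.
exists S; split; last by exists k, 0.
split=> //; exists T => //; apply/seteqP; split.
  rewrite [X in X `<=` _](polytope_hull_vertices hP); apply: conv_hull_min.
    by apply: convex_minkowski_sum; exact: polytope_convex.
  move=> p /[dup] Vp [c /face_set1 cp].
  exists (k *: psi p + 0); first by exists (psi p) => //; case: (ref _ _ Vp cp).
  exists (p - k *: psi p); first by apply: sub_conv_hull; exists p.
  by rewrite addr0 addrC subrK.
move=> _ [_ [q Qq <-] [z Tz <-]]; rewrite addr0 [X in X _](polytope_hull_vertices hP).
apply: finite_hull_separation; [exact: finite_vertices|by exists p0|].
move=> c l Pl; have [p Vp cp] := exists_vertex_face c hP.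
apply: le_trans (Pl _ Vp).
have zp : inner c z <= inner c (p - k *: psi p).
  by move: z Tz; apply: conv_hull_le => _ [p' Vp' <-]; exact: domk.
have [_ /(_ q Qq)] := ref _ _ Vp cp; move: zp; rewrite !innerE; nra.
Qed.

End Summands.

Theorem theorem2p6 (R : realType) (d : nat) (P Q : set 'rV[R]_d)
    (hP : polytope P) (hQ : polytope Q) :
  (exists S : set 'rV[R]_d, summand S P /\ homothetic S Q) <->
  vertices P #= vertices (minkowski_sum P Q).
Proof.
split=> [[S [PS SQ]]|/(card_normal_refinement hP hQ)[psi]].
  have [psi] := summand_normal_refinement PS SQ.
  exact: normal_refinement_card.
exact: normal_refinement_summand.
Qed.
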